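(* Fix a problem type (IP, SE or PS), a step $k$ and data $y_k$. Let $P_{k-1},Q_{k-1}\in\bar{\mathcal{P}}_k(\bar{\mathcal{X}})$, $P_k=F_k(P_{k-1})$, $Q_k^*=F_k(Q_{k-1})$, and write $G_P=\int_{\bar{\mathcal{X}}}g(y_k,\bar x)P_{k-1}(d\bar x)$, $G_Q=\int_{\bar{\mathcal{X}}}g(y_k,\bar x)Q_{k-1}(d\bar x)$. Suppose either (H1) there is $\nu\in\bar{\mathcal{M}}(\bar{\mathcal{X}})$ with $P_{k-1}\ll\nu$, $Q_{k-1}\ll\nu$, $$\int g(y_k,\bar x)\sqrt{\tfrac{dP_{k-1}}{d\nu}\tfrac{dQ_{k-1}}{d\nu}}(\bar x)\nu(d\bar x)\ge\int g(y_k,\bar x)\nu(d\bar x)\int\sqrt{\tfrac{dP_{k-1}}{d\nu}\tfrac{dQ_{k-1}}{d\nu}}(\bar x)\nu(d\bar x)$$ and $\int g(y_k,\bar x)\nu(d\bar x)\ge\sqrt{G_PG_Q}$; or (H2) there is $\nu\in\bar{\mathcal{M}}(\bar{\mathcal{X}})$ with $P_{k-1}\ll\nu$, $Q_{k-1}\ll\nu$, $$\int g(y_k,\bar x)\Big(\sqrt{\tfrac{dP_{k-1}}{d\nu}(\bar x)}-\sqrt{\tfrac{dQ_{k-1}}{d\nu}(\bar x)}\Big)^2\nu(d\bar x)\le\int g(y_k,\bar x)\nu(d\bar x)\int\Big(\sqrt{\tfrac{dP_{k-1}}{d\nu}(\bar x)}-\sqrt{\tfrac{dQ_{k-1}}{d\nu}(\bar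 x)}\Big)^2\nu(d\bar x)$$ and $\int g(y_k,\bar x)\nu(d\bar x)\le\sqrt{G_PG_Q}$ (all integrals over $\bar{\mathcal{X}}$). Then $d_H(P_k,Q_k^* )\le d_H(P_{k-1},Q_{k-1})$.
   Context: Problems and notation. $(\mathcal{X},d_{\mathcal{X}})$ is a Polish metric space; in PS also $\mathcal{X}\times\mathcal{W}$; $dx,dw$ are Lebesgue measure and $\lambda$ is Lebesgue measure on $\mathcal{X}\times\mathcal{W}$. IP: measurable likelihood $h(y_k,x)$, $\tilde F_k\mu(dx)=h(y_k,x)\mu(dx)$. SE: transition density $T_k(x_k,x_{k-1})$ (density in $x_k$), observation density $h_k(y_k,x_k)$, $\tilde F_k\mu(dx)=h_k(y_k,x)(\int T_k(x,x')\mu(dx'))dx$. PS: $T_k(x_k,x_{k-1},w)$, $h_k(y_k,x_k,w)$, for $\mu\ll\lambda$ with density $\pi$, $\tilde F_k\mu(dx,dw)=h_k(y_k,x,w)(\int T_k(x,x',w)\pi(x',w)dx')dxdw$. Evidence $Z_k(\mu)=\tilde F_k\mu(\bar{\mathcal{X}})$; posterior $F_k\mu=\tilde F_k\mu/Z_k(\mu)$. Admissible priors $\bar{\mathcal{P}}_k(\bar{\mathcal{X}})$: IP: probability measures with $0<Z_k(\mu)<\infty$; SE: additionally $\int T_k(x_k,x')\mu(dx')<\infty$ for all $x_k$; PS: $\mu\ll\lambda$, $\int T_k(x_k,x',w)\pi(x',w)dx'<\infty$ for all $x_k,w$, $0<Z_k(\mu)<\infty$. Unified notation: IP: $\bar x=x$,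 $\bar{\mathcal{X}}=\mathcal{X}$, $g(y_k,\bar x)=h(y_k,x)$, $\bar{\mathcal{M}}(\bar{\mathcal{X}})$ = all $\sigma$-finite measures on $\mathcal{X}$. SE: $\bar x=x_{k-1}$, $\bar{\mathcal{X}}=\mathcal{X}$, $g(y_k,\bar x)=\int_{\mathcal{X}}h_k(y_k,x_k)T_k(x_k,x_{k-1})dx_k$, $\bar{\mathcal{M}}$ = all $\sigma$-finite measures on $\mathcal{X}$. PS: $\bar x=(x_{k-1},w)$, $\bar{\mathcal{X}}=\mathcal{X}\times\mathcal{W}$, $g(y_k,\bar x)=\int_{\mathcal{X}}h_k(y_k,x_k,w)T_k(x_k,x_{k-1},w)dx_k$, $\bar{\mathcal{M}}=\{\lambda\}$. Hellinger distance $d_H(\mu,\mu')=\sqrt{\frac12\int(\sqrt{d\mu/d\nu}-\sqrt{d\mu'/d\nu})^2d\nu}$. *)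

(* Defs.v *)
From HB Require Import structures.
From mathcomp Require Import all_boot all_order all_algebra.
From mathcomp Require Import all_classical all_reals all_analysis.
Set Implicit Arguments. Unset Strict Implicit. Unset Printing Implicit Defensive.
Import Order.TTheory GRing.Theory Num.Theory.
Local Open Scope classical_set_scope.
Local Open Scope ring_scope.

Section Generic.
Context {d : measure_display} {T : measurableType d} {R : realType}.
Local Open Scope ereal_scope.

(** [p] is a (finite, nonnegative, measurable) version of the Radon-Nikodym
    derivative dP/dnu; P << nu iff such a p exists (nu sigma-finite). *)
Definition is_density (nu : {measure set T -> \bar R}) (P : set T -> \bar R)
    (p : T -> R) : Prop :=
  [/\ measurable_fun setT p, (forall x, (0 <= p x)%R) &
      forall A, measurable A -> P A = \int[nu]_(x in A) (p x)%:E].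

(** Hellinger distance, computed w.r.t. the dominating measure P + Q
    (the value does not depend on the version of the densities). *)
Definition hellinger (P Q : probability T R) : R :=
  let nu := measure_add P Q in
  let pq := xget (fun _ : T => 0%R, fun _ : T => 0%R)
                 [set pq | is_density nu P pq.1 /\ is_density nu Q pq.2] in
  Num.sqrt (2^-1 * fine (\int[nu]_x
    (((Num.sqrt (pq.1 x) - Num.sqrt (pq.2 x)) ^+ 2)%R)%:E)).

(** Hypothesis (H1) for a given dominating measure nu, with densities p, q
    of P_{k-1}, Q_{k-1} w.r.t. nu; GP, GQ are \int g dP_{k-1}, \int g dQ_{k-1}. *)
Definition hypH1 (g : T -> \bar R) (nu : {measure set T -> \bar R})
    (P Q : set T -> \bar R) (GP GQ : \bar R) : Prop :=
  exists p q, [/\ is_density nu P p, is_density nu Q q,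
    \int[nu]_x (g x * (Num.sqrt (p x * q x))%:E)
      >= (\int[nu]_x g x) * \int[nu]_x (Num.sqrt (p x * q x))%:E &
    \int[nu]_x g x >= sqrte (GP * GQ)].

Definition hypH2 (g : T -> \bar R) (nu : {measure set T -> \bar R})
    (P Q : set T -> \bar R) (GP GQ : \bar R) : Prop :=
  exists p q, [/\ is_density nu P p, is_density nu Q q,
    \int[nu]_x (g x * (((Num.sqrt (p x) - Num.sqrt (q x)) ^+ 2)%R)%:E)
      <= (\int[nu]_x g x) *
         \int[nu]_x (((Num.sqrt (p x) - Num.sqrt (q x)) ^+ 2)%R)%:E &
    \int[nu]_x g x <= sqrte (GP * GQ)].

End Generic.

Section IP.
Context {d : measure_display} {X : measurableType d} {R : realType}.
Local Open Scope ereal_scope.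
Variable h : X -> R. (* x |-> h(y_k, x) *)

Definition Z_IP (mu : set X -> \bar R) : \bar R := \int[mu]_x (h x)%:E.
Definition admissible_IP (mu : set X -> \bar R) : Prop :=
  0 < Z_IP mu < +oo.
Definition post_IP (mu : set X -> \bar R) (A : set X) : \bar R :=
  (\int[mu]_(x in A) (h x)%:E) * ((fine (Z_IP mu))^-1)%:E.
Definition g_IP (x : X) : \bar R := (h x)%:E.
End IP.

Section SE.
Context {d : measure_display} {X : measurableType d} {R : realType}.
Local Open Scope ereal_scope.
Variable leb : {measure set X -> \bar R}.
Variable h : X -> R.            (* x_k |-> h_k(y_k, x_k) *)
Variable Tk : X -> X -> R.      (* (x_k, x_{k-1}) |-> T_k(x_k, x_{k-1}) *)

Definition pred_SE (mu : set X -> \bar R) (x : X) : \bar R :=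
  \int[mu]_x' (Tk x x')%:E.
Definition Z_SE (mu : set X -> \bar R) : \bar R :=
  \int[leb]_x ((h x)%:E * pred_SE mu x).
Definition admissible_SE (mu : set X -> \bar R) : Prop :=
  (forall x, pred_SE mu x < +oo) /\ 0 < Z_SE mu < +oo.
Definition post_SE (mu : set X -> \bar R) (A : set X) : \bar R :=
  (\int[leb]_(x in A) ((h x)%:E * pred_SE mu x)) * ((fine (Z_SE mu))^-1)%:E.
Definition g_SE (x' : X) : \bar R := \int[leb]_x ((h x)%:E * (Tk x x')%:E).
End SE.

Section PS.
Context {d1 d2 : measure_display} {X : measurableType d1} {W : measurableType d2}
  {R : realType}.
Local Open Scope ereal_scope.
Variable lebX : {measure set X -> \bar R}.
Variable h : X -> W -> R.              (* (x_k, w) |-> h_k(y_k, x_k, w) *)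
Variable Tk : X -> X -> W -> R.        (* T_k(x_k, x_{k-1}, w) *)

(** pi is the density of the prior w.r.t. lambda *)
Definition pred_PS (pi : X * W -> R) (z : X * W) : \bar R :=
  \int[lebX]_x' (Tk z.1 x' z.2 * pi (x', z.2))%:E.
Definition Z_PS (lam : set (X * W) -> \bar R) (pi : X * W -> R) : \bar R :=
  \int[lam]_z ((h z.1 z.2)%:E * pred_PS pi z).
Definition admissible_PS (lam : {measure set (X * W) -> \bar R})
    (mu : set (X * W) -> \bar R) (pi : X * W -> R) : Prop :=
  [/\ is_density lam mu pi, (forall z, pred_PS pi z < +oo) & 0 < Z_PS lam pi < +oo].
Definition post_PS (lam : set (X * W) -> \bar R) (pi : X * W -> R)
    (A : set (X * W)) : \bar R :=
  (\int[lam]_(z in A) ((h z.1 z.2)%:E * pred_PS pi z)) *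
    ((fine (Z_PS lam pi))^-1)%:E.
Definition g_PS (z : X * W) : \bar R :=
  \int[lebX]_x ((h x z.2)%:E * (Tk x z.1 z.2)%:E).
End PS.

(* Main.v *)
(** The affinity [\int sqrt (p q) dnu] of [P] and [Q], which equals one minus the
    squared Hellinger distance, has the variational form
      [inf_(s > 0) (\int s dP + \int s^-1 dQ) / 2],
    so it depends neither on the dominating measure nor on the densities.
    In each problem the unnormalized posterior of [P0] is the image of [P0]
    under a kernel of total mass [g]. Pulling a near-optimal [s] for the
    posteriors back through the kernel and applying the pointwise inequality
    [2 sqrt (p q) <= s p + q / s] gives
      [\int g sqrt (p q) dnu <= sqrt (GP GQ) * affinity (P1, Q1)].
    (H1) bounds the left-hand side below by [sqrt (GP GQ) * affinity (P0, Q0)];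
    under (H2) one first expands
      [\int g (sqrt p - sqrt q)^2 dnu = GP + GQ - 2 \int g sqrt (p q) dnu]
    and uses [2 sqrt (GP GQ) <= GP + GQ]. *)
Require Import Defs.
From HB Require Import structures.
From mathcomp Require Import all_boot all_order all_algebra.
From mathcomp Require Import all_classical all_reals all_analysis.
From mathcomp Require Import measurable_realfun ring lra.
Import Order.TTheory GRing.Theory Num.Theory.
Import HBNNSimple.
Local Open Scope classical_set_scope.
Local Open Scope ring_scope.

(** * Measurability of square roots and inverses *)

Lemma measurable_sqrt (R : realType) : measurable_fun setT (@Num.sqrt R).
Proof. exact: continuous_measurable_fun (@sqrt_continuous R). Qed.

Lemma measurable_fun_sqrt {d} {T : measurableType d} {R : realType} (f : T -> R) :
  measurable_fun setT f -> measurable_fun setT (fun x => Num.sqrt (f x)).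
Proof. by move=> mf; exact: measurableT_comp (@measurable_sqrt R) mf. Qed.

(** On nonnegative values the inverse is the real power with exponent [-1]; at [0] both are [0]. *)
Lemma measurable_fun_pos_inv {d} {T : measurableType d} {R : realType} (f : T -> R) :
  measurable_fun setT f -> (forall x, 0 <= f x) ->
  measurable_fun setT (fun x => (f x)^-1).
Proof.
move=> mf f0; rewrite (_ : (fun x => _) = (fun x => f x `^ (-1))).
  exact: measurableT_comp (measurable_powR (-1)) mf.
by apply/funext => x; rewrite powR_inv1.
Qed.

(** * Transfer of integrals along densities and kernels *)

(** The hypothesis on sets extends to simple functions by linearity, and to [f] by monotone
    convergence along the same approximating sequence on both sides. Taking [phi = id] gives
    densities; taking a product measure for [nu] gives kernels. *)
Lemma ge0_integral_transfer {d d'} {Y : measurableType d} {O : measurableType d'}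
    {R : realType} (mu : {measure set Y -> \bar R})
    (nu : {measure set O -> \bar R}) (phi : O -> Y) (k : O -> R) :
  measurable_fun setT phi -> measurable_fun setT k -> (forall w, 0 <= k w) ->
  (forall A, measurable A -> mu A = (\int[nu]_w (\1_A (phi w) * k w)%:E)%E) ->
  forall f : Y -> \bar R, measurable_fun setT f -> (forall y, (0 <= f y)%E) ->
  (\int[mu]_y f y = \int[nu]_w (f (phi w) * (k w)%:E))%E.
Proof.
move=> mphi mk k0 muE f mf f0.
pose h := nnsfun_approx measurableT mf.
have hf y : (EFin \o h n) y @[n --> \oo] --> f y.
  exact: cvg_nnsfun_approx.
have nd_h y : {homo (fun n => h n y) : a b / (a <= b)%N >-> a <= b}.
  by move=> a b ab; exact/lefP/nd_nnsfun_approx.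
have mh n : measurable_fun setT (h n) by exact: measurable_funP.
have -> : (\int[mu]_y f y)%E = limn (fun n => \int[mu]_y (h n y)%:E)%E.
  rewrite -monotone_convergence//.
  - by apply: eq_integral => y _; apply/esym/cvg_lim => //; exact: hf.
  - by move=> n; exact/measurable_EFinP.
  - by move=> n y _; rewrite lee_fin.
  - by move=> y _ a b ab; rewrite lee_fin; exact: nd_h.
have -> : (\int[nu]_w (f (phi w) * (k w)%:E))%E =
    limn (fun n => \int[nu]_w (h n (phi w) * k w)%:E)%E.
  rewrite -monotone_convergence//.
  - apply: eq_integral => w _; apply/esym/cvg_lim => //.
    under eq_fun do rewrite EFinM.
    by apply: cvgeZr => //; exact: hf.
  - move=> n; apply/measurable_EFinP; apply: measurable_funM => //.
    exact: measurableT_comp.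
  - by move=> n w _; rewrite lee_fin mulr_ge0.
  - by move=> w _ a b ab; rewrite lee_fin ler_wpM2r// nd_h.
congr (limn _); apply/funext => n.
have mi r : measurable (h n @^-1` [set r]) by [].
(* At a fixed stage both sides reduce to the finite sum, over the values [r] of [h n], of [r] times
   the measure of the level set. *)
transitivity (\sum_(r \in range (h n)) (r%:E * mu (h n @^-1` [set r])))%E.
  under eq_integral do rewrite fimfunE -fsumEFin//.
  rewrite ge0_integral_fsum//.
  - apply: eq_fsbigr => r _; under eq_integral do rewrite EFinM.
    by rewrite integralZl_indic_nnsfun// integral_indic// setIT.
  - by move=> r; exact/measurable_EFinP/measurable_funM.
  - by move=> r y _; rewrite EFinM; exact: nnfun_muleindic_ge0.
have mik r : measurable_fun setT (fun w => \1_(h n @^-1` [set r]) (phi w) * k w).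
  apply: measurable_funM => //; apply: measurableT_comp mphi.
  exact: measurable_indic.
transitivity (\int[nu]_w (\sum_(r \in range (h n))
   (r * (\1_(h n @^-1` [set r]) (phi w) * k w))%:E))%E; last first.
  apply: eq_integral => w _; rewrite fsumEFin// [in RHS]fimfunE mulr_fsuml.
  by congr (_%:E); apply: eq_fsbigr => r _; rewrite mulrA.
rewrite ge0_integral_fsum//.
(* Being a value [h n y], the scalar [r] is nonnegative, as pulling it out of the integral
   requires. *)
- apply: eq_fsbigr => r /[!inE] -[y _ <-]; under [RHS]eq_integral do rewrite EFinM.
  rewrite ge0_integralZl ?muE ?lee_fin//; first exact/measurable_EFinP.
  by move=> w _; rewrite lee_fin mulr_ge0.
- by move=> r; exact/measurable_EFinP/measurable_funM.
- move=> r w _; rewrite mulrA EFinM mule_ge0 ?lee_fin//.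
  exact: (nnfun_muleindic_ge0 (h n) r (phi w)).
Qed.

Lemma integral_density {d} {T : measurableType d} {R : realType}
    (nu P : {measure set T -> \bar R}) (p : T -> R) :
  is_density nu P p ->
  forall f : T -> \bar R, measurable_fun setT f -> (forall x, (0 <= f x)%E) ->
  (\int[P]_x f x = \int[nu]_x (f x * (p x)%:E))%E.
Proof.
move=> [mp p0 PE]; apply: (@ge0_integral_transfer _ _ _ _ _ P nu id) => // A mA.
rewrite PE// integral_mkcond; apply: eq_integral => x _.
by rewrite epatch_indic /= -EFinM mulrC.
Qed.

Section kernel_transfer.
Context {d1 d2 d3 : measure_display} {X : measurableType d1}
  {Z : measurableType d2} {Y : measurableType d3} {R : realType}.
Variables (m : {sigma_finite_measure set Z -> \bar R})
  (phi : X * Z -> Y) (k : X * Z -> R).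
Hypotheses (mphi : measurable_fun setT phi) (mk : measurable_fun setT k)
  (k0 : forall w, 0 <= k w).

Lemma measurable_kernel_integral (f : Y -> \bar R) :
  measurable_fun setT f -> (forall y, (0 <= f y)%E) ->
  measurable_fun setT (fun x => \int[m]_z (f (phi (x, z)) * (k (x, z))%:E))%E.
Proof.
move=> mf f0; apply: (measurable_fun_fubini_tonelli_F
  (fun w => (f (phi w) * (k w)%:E)%E)) => [|w].
  by apply: emeasurable_funM; [exact: measurableT_comp|exact/measurable_EFinP].
by rewrite mule_ge0 ?lee_fin.
Qed.

(** The hypothesis says that [P] is the image of [P0] under the kernel sending [x] to the
    push-forward by [phi (x, _)] of the measure with density [k (x, _)] with respect to [m]. The
    formula is the transfer from the product of [P0] and [m], unfolded by Tonelli's theorem. *)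
Lemma integral_kernel_transfer (P0 : probability X R)
    (P : {measure set Y -> \bar R}) :
  (forall A, measurable A ->
    P A = (\int[P0]_x \int[m]_z (\1_A (phi (x, z)) * k (x, z))%:E)%E) ->
  forall f : Y -> \bar R, measurable_fun setT f -> (forall y, (0 <= f y)%E) ->
  (\int[P]_y f y = \int[P0]_x \int[m]_z (f (phi (x, z)) * (k (x, z))%:E))%E.
Proof.
move=> PE f mf f0.
rewrite (@ge0_integral_transfer _ _ _ _ _ P (P0 \x m)%E phi k)//.
  rewrite fubini_tonelli1// => [|w]; last by rewrite mule_ge0 ?lee_fin.
  by apply: emeasurable_funM; [exact: measurableT_comp|exact/measurable_EFinP].
move=> A mA; rewrite PE// fubini_tonelli1// => [|w]; last first.
  by rewrite lee_fin mulr_ge0.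
apply/measurable_EFinP; apply: measurable_funM => //.
by apply: measurableT_comp mphi; exact: measurable_indic.
Qed.

(** The lower half of the variational formula, seen through the kernel: both integrals on the right
    pull back along it, and the pointwise inequality is AM-GM with weight [s (phi (x, z))],
    multiplied by [k (x, z)]. [P] and [Q] are general measures so as to cover unnormalized
    posteriors. *)
Lemma affinity_le_kernel (nu : {measure set X -> \bar R})
    (P0 Q0 : probability X R) (p q : X -> R)
    (P Q : {measure set Y -> \bar R}) (s : Y -> R) :
  is_density nu P0 p -> is_density nu Q0 q ->
  (forall A, measurable A ->
    P A = (\int[P0]_x \int[m]_z (\1_A (phi (x, z)) * k (x, z))%:E)%E) ->
  (forall A, measurable A ->
    Q A = (\int[Q0]_x \int[m]_z (\1_A (phi (x, z)) * k (x, z))%:E)%E) ->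
  measurable_fun setT s -> (forall y, 0 < s y) ->
  (2%:E * \int[nu]_x ((\int[m]_z (k (x, z))%:E) * (Num.sqrt (p x * q x))%:E)
   <= \int[P]_y (s y)%:E + \int[Q]_y ((s y)^-1)%:E)%E.
Proof.
move=> dP dQ PE QE ms s0.
have s0' y : 0 <= s y by exact: ltW.
have si0 y : 0 <= (s y)^-1 by rewrite invr_ge0.
have msi := measurable_fun_pos_inv _ ms s0'.
have ems : measurable_fun setT (fun y => (s y)%:E) by exact/measurable_EFinP.
have emsi : measurable_fun setT (fun y => ((s y)^-1)%:E) by exact/measurable_EFinP.
have [mp p0 _] := dP; have [mq q0 _] := dQ.
rewrite (integral_kernel_transfer _ _ PE _ ems)//.
rewrite (integral_kernel_transfer _ _ QE _ emsi)//.
have mF := measurable_kernel_integral _ ems s0'.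
have mG := measurable_kernel_integral _ emsi si0.
have F0 x : (0 <= \int[m]_z ((s (phi (x, z)))%:E * (k (x, z))%:E))%E.
  by apply: integral_ge0 => z _; rewrite mule_ge0 ?lee_fin.
have G0 x : (0 <= \int[m]_z (((s (phi (x, z)))^-1)%:E * (k (x, z))%:E))%E.
  by apply: integral_ge0 => z _; rewrite mule_ge0 ?lee_fin.
rewrite (integral_density _ _ _ dP _ mF F0) (integral_density _ _ _ dQ _ mG G0).
have mkx x : measurable_fun setT (fun z => k (x, z)).
  exact: measurableT_comp mk (pair1_measurable x).
have g0 x : (0 <= \int[m]_z (k (x, z))%:E)%E.
  by apply: integral_ge0 => z _; rewrite lee_fin.
have mg : measurable_fun setT (fun x => \int[m]_z (k (x, z))%:E)%E.
  apply: (measurable_fun_fubini_tonelli_F (fun w => (k w)%:E)) => [|w].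
    exact/measurable_EFinP.
  by rewrite lee_fin.
have msq : measurable_fun setT (fun x => (Num.sqrt (p x * q x))%:E).
  by apply/measurable_EFinP; apply: measurable_fun_sqrt; exact: measurable_funM.
have mFp := emeasurable_funM mF ((measurable_EFinP _ _).2 mp).
have mGq := emeasurable_funM mG ((measurable_EFinP _ _).2 mq).
rewrite -ge0_integralZl//; last 2 first.
- exact: emeasurable_funM.
- by move=> x _; rewrite mule_ge0 ?lee_fin ?sqrtr_ge0.
rewrite -ge0_integralD//; last 2 first.
- by move=> x _; rewrite mule_ge0 ?lee_fin.
- by move=> x _; rewrite mule_ge0 ?lee_fin.
apply: ge0_le_integral => //.
- by move=> x _; rewrite !mule_ge0 ?lee_fin ?sqrtr_ge0.
- by apply: emeasurable_funM => //; exact: emeasurable_funM.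
- exact: emeasurable_funD.
move=> x _.
have mphix : measurable_fun setT (fun z => phi (x, z)).
  exact: measurableT_comp mphi (pair1_measurable x).
have mFx : measurable_fun setT (fun z => (s (phi (x, z)) * k (x, z))%:E).
  by apply/measurable_EFinP/measurable_funM => //; exact: measurableT_comp ms mphix.
have mGx : measurable_fun setT (fun z => ((s (phi (x, z)))^-1 * k (x, z))%:E).
  by apply/measurable_EFinP/measurable_funM => //; exact: measurableT_comp msi mphix.
have ekx : measurable_fun setT (fun z => (k (x, z))%:E) by exact/measurable_EFinP.
(* The factors depending on [x] alone move inside the integrals over [z], so that the comparison
   becomes pointwise in [(x, z)]. *)
rewrite muleCA -EFinM -!ge0_integralZr ?lee_fin ?mulr_ge0 ?sqrtr_ge0//; last 3 first.
- by move=> z _; rewrite mule_ge0 ?lee_fin.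
- by move=> z _; rewrite mule_ge0 ?lee_fin.
- by move=> z _; rewrite lee_fin.
rewrite -ge0_integralD//; last 4 first.
- by move=> z _; rewrite !mule_ge0 ?lee_fin.
- by apply: emeasurable_funM.
- by move=> z _; rewrite !mule_ge0 ?lee_fin.
- by apply: emeasurable_funM.
apply: ge0_le_integral => //.
- by move=> z _; rewrite mule_ge0 ?lee_fin ?mulr_ge0 ?sqrtr_ge0.
- by apply: emeasurable_funM.
- by apply: emeasurable_funD; exact: emeasurable_funM.
move=> z _; rewrite -!EFinM -EFinD lee_fin.
set t := s _; have t0 : 0 < t by exact: s0.
have -> : t * k (x, z) * p x + t^-1 * k (x, z) * q x
  = k (x, z) * (t * p x + t^-1 * q x) by ring.
apply: ler_wpM2l => //.
(* AM-GM for t p and q / t *)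
have u0 : 0 <= t * p x by rewrite mulr_ge0// ltW.
have v0 : 0 <= t^-1 * q x by rewrite mulr_ge0// invr_ge0 ltW.
have -> : p x * q x = (t * p x) * (t^-1 * q x) by field; rewrite gt_eqF.
rewrite sqrtrM// -{2}(sqr_sqrtr u0) -{2}(sqr_sqrtr v0).
by rewrite -subr_ge0; set a := Num.sqrt _; set b := Num.sqrt _;
  rewrite (_ : _ - _ = (a - b) ^+ 2) ?sqr_ge0//; ring.
Qed.

End kernel_transfer.

(** * The variational formula for the affinity *)

Lemma integral_prob_cst {d} {T : measurableType d} {R : realType}
    (P : probability T R) (r : \bar R) : (\int[P]_x r = r)%E.
Proof. by rewrite integral_cst// [X in (_ * X)%E]probability_setT mule1. Qed.

(** The case of the identity kernel: [phi = fst], [k = 1], and any probability measure as [m], here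
    [P]. *)
Lemma affinity_le {d} {T : measurableType d} {R : realType}
    (nu : {measure set T -> \bar R}) (P Q : probability T R) (p q s : T -> R) :
  is_density nu P p -> is_density nu Q q ->
  measurable_fun setT s -> (forall y, 0 < s y) ->
  (2%:E * \int[nu]_x (Num.sqrt (p x * q x))%:E
   <= \int[P]_y (s y)%:E + \int[Q]_y ((s y)^-1)%:E)%E.
Proof.
move=> dP dQ ms s0.
have PE (P' : probability T R) A : measurable A ->
    P' A = (\int[P']_x \int[P]_z (\1_A (x, z).1 * 1)%:E)%E.
  move=> mA; under eq_integral do rewrite /= integral_prob_cst mulr1.
  by rewrite integral_indic ?setIT.
have := affinity_le_kernel P fst (fun=> 1) measurable_fst (measurable_cst _)
  (fun=> ler01) nu P Q p q P Q s dP dQ (PE P) (PE Q) ms s0.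
by under eq_integral do rewrite integral_prob_cst mul1e.
Qed.

(** This integrates [(sqrt p - sqrt q)^2 + 2 sqrt (p q) = p + q] against [g]. The sum form avoids
    subtracting integrals that may be infinite. *)
Lemma integral_sqrt_diff_sqr {d} {T : measurableType d} {R : realType}
    (nu : {measure set T -> \bar R}) (P Q : probability T R) (p q : T -> R)
    (g : T -> \bar R) :
  is_density nu P p -> is_density nu Q q ->
  measurable_fun setT g -> (forall x, (0 <= g x)%E) ->
  (\int[nu]_x (g x * ((Num.sqrt (p x) - Num.sqrt (q x)) ^+ 2)%:E)
   + 2%:E * \int[nu]_x (g x * (Num.sqrt (p x * q x))%:E)
   = \int[P]_x g x + \int[Q]_x g x)%E.
Proof.
move=> dP dQ mg g0; have [mp p0 _] := dP; have [mq q0 _] := dQ.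
have msd : measurable_fun setT
    (fun x => ((Num.sqrt (p x) - Num.sqrt (q x)) ^+ 2)%:E).
  apply/measurable_EFinP; apply: measurable_funX.
  by apply: measurable_funB; exact: measurable_fun_sqrt.
have msq : measurable_fun setT (fun x => (Num.sqrt (p x * q x))%:E).
  by apply/measurable_EFinP; apply: measurable_fun_sqrt; exact: measurable_funM.
have mep : measurable_fun setT (fun x => (p x)%:E) by exact/measurable_EFinP.
have meq : measurable_fun setT (fun x => (q x)%:E) by exact/measurable_EFinP.
have gM0 r x : 0 <= r -> (0 <= g x * r%:E)%E by move=> r0; rewrite mule_ge0 ?lee_fin.
rewrite (integral_density _ _ _ dP _ mg g0) (integral_density _ _ _ dQ _ mg g0).
rewrite -ge0_integralZl//; last 2 first.
- exact: emeasurable_funM.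
- by move=> x _; rewrite gM0 ?sqrtr_ge0.
rewrite -!ge0_integralD//.
- apply: eq_integral => x _.
  rewrite muleCA -EFinM -!ge0_muleDr ?lee_fin ?sqr_ge0 ?mulr_ge0 ?sqrtr_ge0//.
  rewrite -!EFinD sqrtrM//; congr (_ * _%:E)%E.
  by rewrite -[in RHS](sqr_sqrtr (p0 x)) -[in RHS](sqr_sqrtr (q0 x)); ring.
- by move=> x _; rewrite gM0.
- exact: emeasurable_funM.
- by move=> x _; rewrite gM0.
- exact: emeasurable_funM.
- by move=> x _; rewrite gM0 ?sqr_ge0.
- exact: emeasurable_funM.
- by move=> x _; rewrite mule_ge0 ?gM0 ?sqrtr_ge0.
- by apply: emeasurable_funM => //; exact: emeasurable_funM.
Qed.

Lemma affinity_hellinger_integral {d} {T : measurableType d} {R : realType}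
    (nu : {measure set T -> \bar R}) (P Q : probability T R) (p q : T -> R) :
  is_density nu P p -> is_density nu Q q ->
  (\int[nu]_x ((Num.sqrt (p x) - Num.sqrt (q x)) ^+ 2)%:E
   + 2%:E * \int[nu]_x (Num.sqrt (p x * q x))%:E = 2%:E)%E.
Proof.
move=> dP dQ.
have := integral_sqrt_diff_sqr _ _ _ _ _ (cst 1%E) dP dQ (measurable_cst _)
  (fun=> lee01).
rewrite !integral_prob_cst; under eq_integral do rewrite mul1e.
by under [X in (_ + _ * X)%E]eq_integral do rewrite mul1e.
Qed.

(** The upper half of the variational formula. With [a = sqrt p], [b = sqrt q] and [c = a + b], the
    regularized [s] gives [s p + q / s <= 2 a b + h c^2], and [c^2 <= 2 (p + q)] bounds the integral
    of the error by [4 h = e]. *)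
Lemma affinity_approx {d} {T : measurableType d} {R : realType}
    (nu : {measure set T -> \bar R}) (P Q : probability T R) (p q : T -> R) (e : R) :
  is_density nu P p -> is_density nu Q q -> 0 < e ->
  exists s : T -> R, [/\ measurable_fun setT s, (forall y, 0 < s y) &
    (\int[P]_y (s y)%:E + \int[Q]_y ((s y)^-1)%:E
     <= 2%:E * \int[nu]_x (Num.sqrt (p x * q x))%:E + e%:E)%E].
Proof.
move=> dP dQ e0; have [mp p0 _] := dP; have [mq q0 _] := dQ.
pose a x := Num.sqrt (p x); pose b x := Num.sqrt (q x).
have a0 x : 0 <= a x by exact: sqrtr_ge0.
have b0 x : 0 <= b x by exact: sqrtr_ge0.
have ma : measurable_fun setT a by exact: measurable_fun_sqrt.
have mb : measurable_fun setT b by exact: measurable_fun_sqrt.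
pose c x := a x + b x; pose h := e / 4.
have h0 : 0 < h by rewrite divr_gt0.
have c0 x : 0 <= c x by rewrite addr_ge0.
have mc : measurable_fun setT c by exact: measurable_funD.
(* a regularization of sqrt (q / p), the minimizer of s p + q / s *)
pose s x := if c x == 0 then 1 else (b x + h * c x) / (a x + h * c x).
have pos x : c x != 0 -> 0 < h * c x.
  by move=> cx; rewrite mulr_gt0// lt0r cx c0.
have s0 x : 0 < s x.
  rewrite /s; case: eqVneq => [//|/pos cx /=].
  by apply: divr_gt0; rewrite ltr_wpDl.
have ms : measurable_fun setT s.
  apply: measurable_fun_ifT => //; first exact: measurable_fun_eqr.
  apply: measurable_funM; first by apply: measurable_funD => //; exact: measurable_funM.
  apply: measurable_fun_pos_inv => [|x]; last by rewrite addr_ge0// mulr_ge0// ltW.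
  by apply: measurable_funD => //; exact: measurable_funM.
have si0 x : 0 <= (s x)^-1 by rewrite invr_ge0 ltW.
have msi : measurable_fun setT (fun x => ((s x)^-1)%:E).
  by apply/measurable_EFinP; apply: measurable_fun_pos_inv => // x; exact: ltW.
have ems : measurable_fun setT (fun x => (s x)%:E) by exact/measurable_EFinP.
have es0 x : (0 <= (s x)%:E)%E by rewrite lee_fin ltW.
have msq : measurable_fun setT (fun x => (Num.sqrt (p x * q x))%:E).
  by apply/measurable_EFinP; apply: measurable_fun_sqrt; exact: measurable_funM.
have mep : measurable_fun setT (fun x => (p x)%:E) by exact/measurable_EFinP.
have meq : measurable_fun setT (fun x => (q x)%:E) by exact/measurable_EFinP.
have int1 (P' : probability T R) p' : is_density nu P' p' ->
    (\int[nu]_x (p' x)%:E = 1)%E.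
  by move=> [_ _ /(_ setT measurableT)] <-; rewrite probability_setT.
exists s; split => //.
rewrite (integral_density _ _ _ dP _ ems es0) (integral_density _ _ _ dQ _ msi)//.
(* Since [p] and [q] have integral [1], the error [e] is the integral of [2 h (p + q)]; the claim
   then becomes pointwise. *)
have -> : e%:E = ((2 * h)%:E * (\int[nu]_x (p x)%:E + \int[nu]_x (q x)%:E))%E.
  by rewrite (int1 _ _ dP) (int1 _ _ dQ) -EFinD -EFinM; congr EFin; rewrite /h; field.
have h20 : (0 <= (2 * h)%:E)%E by rewrite lee_fin mulr_ge0// ltW.
have sM0 x : (0 <= (s x)%:E * (p x)%:E)%E by rewrite mule_ge0 ?lee_fin// ltW.
have siM0 x : (0 <= ((s x)^-1)%:E * (q x)%:E)%E by rewrite mule_ge0 ?lee_fin.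
rewrite -!ge0_integralD//; try by [move=> ? _; rewrite lee_fin|exact: emeasurable_funM].
have mpq : measurable_fun setT (fun x => (p x)%:E + (q x)%:E)%E by exact: emeasurable_funD.
rewrite -!ge0_integralZl//; last first.
  by move=> x _; rewrite adde_ge0 ?lee_fin.
rewrite -ge0_integralD//; last 3 first.
- exact: emeasurable_funM.
- by move=> x _; rewrite mule_ge0 ?adde_ge0 ?lee_fin.
- exact: emeasurable_funM.
apply: ge0_le_integral => //.
- by move=> x _; rewrite adde_ge0.
- by apply: emeasurable_funD; exact: emeasurable_funM.
- by apply: emeasurable_funD; exact: emeasurable_funM.
move=> x _; rewrite -!EFinM -!EFinD lee_fin sqrtrM// -/(a x) -/(b x).
have pE : p x = a x ^+ 2 by rewrite sqr_sqrtr.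
have qE : q x = b x ^+ 2 by rewrite sqr_sqrtr.
rewrite pE qE /s; case: eqVneq => [cx|/pos cx].
  (* Where [c x = 0] both densities vanish, so the default value [1] of [s] contributes nothing. *)
  have /eqP := cx; rewrite paddr_eq0// => /andP[/eqP -> /eqP ->].
  by rewrite !(expr0n, mulr0, mul0r, addr0, lexx).
have ca : 0 < a x + h * c x by rewrite ltr_wpDl.
have cb : 0 < b x + h * c x by rewrite ltr_wpDl.
(* One factor [u] of [u ^ 2] is absorbed by the denominator [u + w]. The bound serves [s p] with
   [(a, b)] and [q / s] with [(b, a)]. *)
have bound u v (w := h * c x) : 0 <= u -> 0 <= v -> 0 < u + w ->
    (v + w) / (u + w) * u ^+ 2 <= u * (v + w).
  move=> u0 v0 uw; rewrite mulrAC ler_pdivrMr//.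
  rewrite (_ : u * _ * _ = (v + w) * u ^+ 2 + u * (v + w) * w); last by ring.
  by rewrite lerDl !mulr_ge0// ?addr_ge0// ltW.
rewrite invf_div (le_trans (lerD (bound _ _ (a0 x) (b0 x) ca)
  (bound _ _ (b0 x) (a0 x) cb)))//.
(* What remains is [h (a + b)^2 <= 2 h (a^2 + b^2)], that is, [0 <= h (a - b)^2]. *)
have := sqr_ge0 (a x - b x); move: (ltW h0); rewrite /c => ? ?; nra.
Qed.

(** The variational bounds involve [s] only through integrals against [P] and [Q], so an [s] that is
    optimal up to [e] for one choice of densities also tests the other. Letting [e] tend to [0]
    gives one inequality, and symmetry the other. *)
Lemma affinity_unique {d} {T : measurableType d} {R : realType}
    (nu nu' : {measure set T -> \bar R}) (P Q : probability T R) (p q p' q' : T -> R) :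
  is_density nu P p -> is_density nu Q q ->
  is_density nu' P p' -> is_density nu' Q q' ->
  (\int[nu]_x (Num.sqrt (p x * q x))%:E = \int[nu']_x (Num.sqrt (p' x * q' x))%:E)%E.
Proof.
have le (m m' : {measure set T -> \bar R}) u v u' v' :
    is_density m P u -> is_density m Q v ->
    is_density m' P u' -> is_density m' Q v' ->
    (\int[m]_x (Num.sqrt (u x * v x))%:E <= \int[m']_x (Num.sqrt (u' x * v' x))%:E)%E.
  move=> du dv du' dv'.
  rewrite -(@lee_pmul2l _ 2%:E)// ?lte_fin//; apply/lee_addgt0Pr => e e0.
  have [s [ms s0 le_s]] := affinity_approx _ _ _ _ _ e du' dv' e0.
  exact: le_trans (affinity_le _ _ _ _ _ _ du dv ms s0) le_s.
by move=> dp dq dp' dq'; apply/eqP; rewrite eq_le !le.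
Qed.

(** * Existence of densities, and the Hellinger distance through the affinity *)

Section measure_add_finite.
Context {d} {T : measurableType d} {R : realType}.
Variables m1 m2 : {finite_measure set T -> \bar R}.

(** Finiteness makes the sum sigma-finite, as the Radon-Nikodym theorem requires of a dominating
    measure. *)
Let measure_add_fin_num : fin_num_fun (measure_add m1 m2).
Proof. by move=> A mA; rewrite measure_addE fin_numD !fin_num_measure. Qed.

HB.instance Definition _ := Measure.copy (measure_add m1 m2)
  (msum (fun n => if n is 0%N then m1 : measure T R else m2) 2).
HB.instance Definition _ := Measure_isFinite.Build _ _ _ (measure_add m1 m2)
  measure_add_fin_num.

End measure_add_finite.

(** The Radon-Nikodym derivative obtained is finite everywhere, so [fine] makes it real-valued
    without changing it. *)
Lemma density_exists {d} {T : measurableType d} {R : realType}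
    (P : {finite_measure set T -> \bar R}) (nu : {sigma_finite_measure set T -> \bar R}) :
  P `<< nu -> exists p, is_density nu P p.
Proof.
move=> /radon_nikodym_sigma_finite[f [f0 ffin intf fE]].
have fineE x : (fine (f x))%:E = f x by rewrite fineK.
exists (fine \o f); split.
- apply/measurable_EFinP; rewrite (_ : _ \o _ = f); last exact/funext.
  exact: measurable_int intf.
- by move=> x; rewrite fine_ge0.
- by move=> A mA; rewrite fE//; apply: eq_integral => x _; rewrite /= fineE.
Qed.

(** Each measure is dominated by the sum. Hence the [xget] in [hellinger] picks genuine densities
    and never its default pair. *)
Lemma density_measure_add {d} {T : measurableType d} {R : realType}
    (P Q : {finite_measure set T -> \bar R}) :
  exists p q, is_density (measure_add P Q) P p /\ is_density (measure_add P Q) Q q.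
Proof.
have [p dp] : exists p, is_density (measure_add P Q) P p.
  apply: density_exists; apply/null_content_dominatesP => A mA.
  by rewrite /= measure_addE => /eqP; rewrite padde_eq0// => /andP[/eqP].
have [q dq] : exists q, is_density (measure_add P Q) Q q.
  apply: density_exists; apply/null_content_dominatesP => A mA.
  by rewrite /= measure_addE => /eqP; rewrite padde_eq0// => /andP[_ /eqP].
by exists p, q.
Qed.

(** By uniqueness of the affinity, the densities picked in [hellinger] may be replaced by any
    others, over any dominating measure. Half of [D = 2 - 2 r] is [1 - r]. *)
Lemma hellingerE {d} {T : measurableType d} {R : realType}
    (nu : {measure set T -> \bar R}) (P Q : probability T R) (p q : T -> R) :
  is_density nu P p -> is_density nu Q q ->
  exists r D : R,
    [/\ (\int[nu]_x (Num.sqrt (p x * q x))%:E = r%:E)%E,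
        (\int[nu]_x ((Num.sqrt (p x) - Num.sqrt (q x)) ^+ 2)%:E = D%:E)%E,
        D + 2 * r = 2 & hellinger P Q = Num.sqrt (1 - r)].
Proof.
move=> dp dq.
have fin (m : {measure set T -> \bar R}) u v : is_density m P u -> is_density m Q v ->
    exists r D : R,
    [/\ (\int[m]_x (Num.sqrt (u x * v x))%:E = r%:E)%E,
        (\int[m]_x ((Num.sqrt (u x) - Num.sqrt (v x)) ^+ 2)%:E = D%:E)%E &
        D + 2 * r = 2].
  move=> du dv; have := affinity_hellinger_integral _ _ _ _ _ du dv.
  set D := (\int[_]_x _)%E; set r := (\int[_]_x _)%E => Dr.
  have D0 : (0 <= D)%E by apply: integral_ge0 => x _; rewrite lee_fin sqr_ge0.
  have r0 : (0 <= r)%E by apply: integral_ge0 => x _; rewrite lee_fin sqrtr_ge0.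
  (* Two nonnegative terms with the finite sum [2] are themselves finite. *)
  move: D r D0 r0 Dr => [D| |] [r| |]//= D0 r0.
  - by move=> [] Dr; exists r, D.
  - by rewrite gt0_muley ?lte_fin.
  - by rewrite gt0_muley ?lte_fin.
have [r [D [rE DE Dr]]] := fin _ _ _ dp dq; exists r, D; split => //.
rewrite /hellinger; set pq0 := (_, _); set S := [set pq | _].
have [dp1 dq1] : S (xget pq0 S).
  by apply: xgetPex; have [u [v ?]] := density_measure_add P Q; exists (u, v).
have [r1 [D1 [rE1 -> Dr1]]] := fin _ _ _ dp1 dq1; congr Num.sqrt.
have [] : r1%:E = r%:E by rewrite -rE -rE1; exact: affinity_unique dp1 dq1 dp dq.
by move=> /= r1r; lra.
Qed.

(** * Contraction for posteriors given by a common kernel *)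

Section posterior.
Context {d1 d2 d3 : measure_display} {X : measurableType d1}
  {Z : measurableType d2} {Y : measurableType d3} {R : realType}.
Variables (m : {sigma_finite_measure set Z -> \bar R})
  (phi : X * Z -> Y) (k : X * Z -> R).
Hypotheses (mphi : measurable_fun setT phi) (mk : measurable_fun setT k)
  (k0 : forall w, 0 <= k w).
Variables (P0 Q0 : probability X R) (P1 Q1 : probability Y R).

(** The kernel bound is applied to the unnormalized posteriors [a P1] and [b Q1], with an [s] nearly
    optimal for [P1] and [Q1], rescaled to balance the two masses. *)
Lemma posterior_affinity (a b : R) (nu : {measure set X -> \bar R}) (p q : X -> R)
    (mu : {measure set Y -> \bar R}) (p1 q1 : Y -> R) :
  0 < a -> 0 < b ->
  (forall A, measurable A -> a%:E * P1 A =
    \int[P0]_x \int[m]_z (\1_A (phi (x, z)) * k (x, z))%:E)%E ->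
  (forall A, measurable A -> b%:E * Q1 A =
    \int[Q0]_x \int[m]_z (\1_A (phi (x, z)) * k (x, z))%:E)%E ->
  is_density nu P0 p -> is_density nu Q0 q ->
  is_density mu P1 p1 -> is_density mu Q1 q1 ->
  (\int[nu]_x ((\int[m]_z (k (x, z))%:E) * (Num.sqrt (p x * q x))%:E)
   <= (Num.sqrt (a * b))%:E * \int[mu]_y (Num.sqrt (p1 y * q1 y))%:E)%E.
Proof.
move=> a0 b0 aE bE dp dq dp1 dq1; apply/lee_addgt0Pr => e e0.
set c := Num.sqrt (a * b).
have c0 : 0 < c by rewrite sqrtr_gt0 mulr_gt0.
have [r [_ [rE _ _ _]]] := hellingerE _ _ _ _ _ dp1 dq1.
(* The factor [c] will turn this error into [2 * e], which matches the goal once it is doubled. *)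
have e'0 : 0 < 2 * e / c by rewrite divr_gt0// mulr_gt0.
have [s [ms s0 le_s]] := affinity_approx _ _ _ _ _ _ dp1 dq1 e'0.
(* This scale makes [a * u] and [b / u] both equal to [c], so the two integrals get the same
   factor. *)
pose u := c / a; have u0 : 0 < u by rewrite divr_gt0.
have au : a * u = c by rewrite /u; field; rewrite gt_eqF.
have bu : b * u^-1 = c.
  have cc : c * c = a * b by rewrite -expr2 sqr_sqrtr// mulr_ge0// ltW.
  by rewrite /u invf_div mulrA [b * a]mulrC -cc mulfK// gt_eqF.
have ms0 y : 0 < s y * u by rewrite mulr_gt0.
have msu : measurable_fun setT (fun y => s y * u) by exact: measurable_funM.
have aE' A : measurable A -> mscale (NngNum (ltW a0)) P1 A = _ := aE A.
have bE' A : measurable A -> mscale (NngNum (ltW b0)) Q1 A = _ := bE A.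
rewrite -(@lee_pmul2l _ 2%:E)// ?lte_fin//.
apply: (le_trans (affinity_le_kernel m phi k mphi mk k0 nu P0 Q0 p q
  (mscale (NngNum (ltW a0)) P1) (mscale (NngNum (ltW b0)) Q1) _ dp dq aE' bE' msu ms0)).
have si0 y : 0 <= (s y)^-1 by rewrite invr_ge0 ltW.
have msi : measurable_fun setT (fun y => (s y)^-1).
  by apply: measurable_fun_pos_inv => // y; exact: ltW.
have msui : measurable_fun setT (fun y => (s y * u)^-1).
  by apply: measurable_fun_pos_inv => // y; exact: ltW.
rewrite !ge0_integral_mscale//; try by [exact/measurable_EFinP |
  move=> y _; rewrite lee_fin ?invr_ge0 ltW].
have -> : (\int[P1]_y (s y * u)%:E = u%:E * \int[P1]_y (s y)%:E)%E.
  rewrite -ge0_integralZl ?lee_fin ?(ltW u0)//.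
  - by apply: eq_integral => y _; rewrite -EFinM mulrC.
  - exact/measurable_EFinP.
  - by move=> y _; rewrite lee_fin ltW.
have -> : (\int[Q1]_y ((s y * u)^-1)%:E = u^-1%:E * \int[Q1]_y ((s y)^-1)%:E)%E.
  rewrite -ge0_integralZl ?lee_fin ?invr_ge0 ?(ltW u0)//.
  - by apply: eq_integral => y _; rewrite -EFinM invfM mulrC.
  - exact/measurable_EFinP.
  - by move=> y _; rewrite lee_fin.
rewrite /= !muleA -!EFinM au bu -ge0_muleDr; last 2 first.
- by apply: integral_ge0 => y _; rewrite lee_fin ltW.
- by apply: integral_ge0 => y _; rewrite lee_fin.
apply: (le_trans (lee_wpmul2l _ le_s)); first by rewrite lee_fin ltW.
rewrite rE -!EFinM lee_fin.
suff -> : c * (2 * r + 2 * e / c) = 2 * (c * r + e) by [].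
by field; rewrite gt_eqF.
Qed.

(** The common core of the three problems. Since the Hellinger distance is [sqrt (1 - affinity)], it
    suffices to compare affinities after multiplication by the positive [c = sqrt (GP GQ)]. *)
Lemma posterior_hellinger_le (g : X -> \bar R) (nu : {measure set X -> \bar R}) :
  let GP := (\int[P0]_x g x)%E in let GQ := (\int[Q0]_x g x)%E in
  (forall x, g x = \int[m]_z (k (x, z))%:E)%E ->
  (0 < GP < +oo)%E -> (0 < GQ < +oo)%E ->
  (forall A, measurable A -> P1 A =
    (\int[P0]_x \int[m]_z (\1_A (phi (x, z)) * k (x, z))%:E) * ((fine GP)^-1)%:E)%E ->
  (forall A, measurable A -> Q1 A =
    (\int[Q0]_x \int[m]_z (\1_A (phi (x, z)) * k (x, z))%:E) * ((fine GQ)^-1)%:E)%E ->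
  hypH1 g nu P0 Q0 GP GQ \/ hypH2 g nu P0 Q0 GP GQ ->
  hellinger P1 Q1 <= hellinger P0 Q0.
Proof.
move=> GP GQ gE GP0 GQ0.
have g0 x : (0 <= g x)%E by rewrite gE; apply: integral_ge0 => z _; rewrite lee_fin.
have mg : measurable_fun setT g.
  rewrite (_ : g = fubini_F m (EFin \o k)); last exact/funext.
  by apply: measurable_fun_fubini_tonelli_F => [|w]; [exact/measurable_EFinP|rewrite lee_fin].
have GPD u v : is_density nu P0 u -> is_density nu Q0 v -> _ =
  (GP + GQ)%E := fun du dv => integral_sqrt_diff_sqr nu P0 Q0 u v g du dv mg g0.
move: GP GQ GP0 GQ0 GPD => [a| |] [b| |]//; rewrite ?ltxx ?andbF//.
rewrite !ltry !andbT !lte_fin /= => a0 b0 GPD PE QE H.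
have unnorm (P : probability Y R) (c : R) (I : \bar R) A : 0 < c ->
    P A = (I * c^-1%:E)%E -> (c%:E * P A = I)%E.
  by move=> c0 ->; rewrite muleCA -EFinM mulfV ?mule1// gt_eqF.
have [p1 [q1 [dp1 dq1]]] := density_measure_add P1 Q1.
have [r1 [D1 [r1E _ _ ->]]] := hellingerE _ _ _ _ _ dp1 dq1.
set c := Num.sqrt (a * b) in H *.
have c0 : 0 < c by rewrite sqrtr_gt0 mulr_gt0.
have aff p q : is_density nu P0 p -> is_density nu Q0 q ->
    (\int[nu]_x (g x * (Num.sqrt (p x * q x))%:E) <= (c * r1)%:E)%E.
  move=> dp dq; under eq_integral do rewrite gE.
  rewrite EFinM -r1E; apply: posterior_affinity dp dq dp1 dq1 => // A mA.
  - exact: unnorm (PE _ mA).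
  - exact: unnorm (QE _ mA).
suff [p [q [dp dq r_le]]] : exists p q, [/\ is_density nu P0 p, is_density nu Q0 q &
    (c%:E * \int[nu]_x (Num.sqrt (p x * q x))%:E <= (c * r1)%:E)%E].
  have [r [D [rE _ _ ->]]] := hellingerE _ _ _ _ _ dp dq.
  by apply: ler_wsqrtr; rewrite lerB//; move: r_le; rewrite rE -EFinM lee_fin ler_pM2l.
case: H => -[p [q [dp dq Hpq Hg]]]; exists p, q; split => //;
  have [r [D [rE DE Dr _]]] := hellingerE _ _ _ _ _ dp dq; have L := aff _ _ dp dq.
(* Under (H1) the chain is [c r <= (\int g) r <= \int g sqrt (p q) <= c r1]. *)
- apply: le_trans L; apply: le_trans Hpq; rewrite rE.
  apply: lee_wpmul2r => //.
  by rewrite -rE; apply: integral_ge0 => x _; rewrite lee_fin sqrtr_ge0.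
(* Under (H2) the weighted squared difference is at most [c D]. Adding twice [L] gives
   [a + b <= c D + 2 c r1]; with [2 c <= a + b] and [D = 2 - 2 r] this is [c r <= c r1]. *)
- rewrite rE; rewrite DE in Hpq.
  have D0 : (0 <= D%:E)%E.
    by rewrite -DE; apply: integral_ge0 => x _; rewrite lee_fin sqr_ge0.
  have S := le_trans Hpq (lee_wpmul2r D0 Hg).
  have e2 : (0 <= 2%:E :> \bar R)%E by rewrite lee_fin.
  have := leeD S (lee_wpmul2l e2 L).
  rewrite GPD// /= -!EFinM -!EFinD !lee_fin -/c.
  have ab : 2 * c <= a + b.
    rewrite /c sqrtrM ?(ltW a0)//.
    have := sqr_ge0 (Num.sqrt a - Num.sqrt b).
    by have := sqr_sqrtr (ltW a0); have := sqr_sqrtr (ltW b0); nra.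
  have : c * (D + 2 * r) = c * 2 by rewrite Dr.
  by lra.
Qed.

End posterior.

(** * The kernels of the three problems *)

Lemma integral_setE {d} {T : measurableType d} {R : realType}
    (mu : {measure set T -> \bar R}) (A : set T) (f : T -> \bar R) :
  (\int[mu]_(x in A) f x = \int[mu]_x ((\1_A x)%:E * f x))%E.
Proof.
rewrite integral_mkcond; apply: eq_integral => x _.
by rewrite epatch_indic /= muleC.
Qed.

(** The kernel is [h x] times the Dirac mass at [x]: [phi = fst], and [k] ignores the second
    coordinate, which is integrated against the probability measure [P0]. *)
Lemma IP_hellinger_le {R : realType} {d} {X : measurableType d} (h : X -> R)
    (P0 Q0 P1 Q1 : probability X R) (nu : {measure set X -> \bar R}) :
  measurable_fun setT h -> (forall x, 0 <= h x) ->
  admissible_IP h P0 -> admissible_IP h Q0 ->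
  (forall A, measurable A -> P1 A = post_IP h P0 A) ->
  (forall A, measurable A -> Q1 A = post_IP h Q0 A) ->
  let GP := (\int[P0]_x g_IP h x)%E in
  let GQ := (\int[Q0]_x g_IP h x)%E in
  hypH1 (g_IP h) nu P0 Q0 GP GQ \/ hypH2 (g_IP h) nu P0 Q0 GP GQ ->
  hellinger P1 Q1 <= hellinger P0 Q0.
Proof.
move=> mh h0 aP aQ PE QE GP GQ.
have mk : measurable_fun setT (fun w : X * X => h w.1).
  exact: measurableT_comp measurable_fst.
have post (P : probability X R) A : post_IP h P A =
    ((\int[P]_x \int[P0]_z (\1_A (x, z).1 * h (x, z).1)%:E) *
      ((fine (\int[P]_x g_IP h x))^-1)%:E)%E.
  rewrite /post_IP integral_setE; congr (_ * _)%E.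
  by apply: eq_integral => x _ /=; rewrite integral_prob_cst EFinM.
apply: (posterior_hellinger_le P0 fst _ measurable_fst mk (fun w => h0 w.1)) => //.
- by move=> x; rewrite /= integral_prob_cst.
- by move=> A mA; rewrite PE// post.
- by move=> A mA; rewrite QE// post.
Qed.

(** The kernel sends the old state [x'] to the measure with density [h x * Tk x x'] in the new state
    [x], so [phi = snd]. *)
Lemma SE_hellinger_le {R : realType} {d} {X : measurableType d}
    (leb : {sigma_finite_measure set X -> \bar R}) (h : X -> R) (Tk : X -> X -> R)
    (P0 Q0 P1 Q1 : probability X R) (nu : {measure set X -> \bar R}) :
  measurable_fun setT h -> (forall x, 0 <= h x) ->
  measurable_fun setT (fun z : X * X => Tk z.1 z.2) ->
  (forall x x', 0 <= Tk x x') ->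
  (0 < Z_SE leb h Tk P0 < +oo)%E -> (0 < Z_SE leb h Tk Q0 < +oo)%E ->
  (forall A, measurable A -> P1 A = post_SE leb h Tk P0 A) ->
  (forall A, measurable A -> Q1 A = post_SE leb h Tk Q0 A) ->
  let GP := (\int[P0]_x g_SE leb h Tk x)%E in
  let GQ := (\int[Q0]_x g_SE leb h Tk x)%E in
  hypH1 (g_SE leb h Tk) nu P0 Q0 GP GQ \/ hypH2 (g_SE leb h Tk) nu P0 Q0 GP GQ ->
  hellinger P1 Q1 <= hellinger P0 Q0.
Proof.
move=> mh h0 mT T0 ZP ZQ PE QE GP GQ.
have mT' : measurable_fun setT (fun w : X * X => Tk w.2 w.1).
  exact: measurableT_comp mT (measurable_fun_pair measurable_snd measurable_fst).
have mk : measurable_fun setT (fun w : X * X => h w.2 * Tk w.2 w.1).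
  by apply: measurable_funM => //; exact: measurableT_comp mh measurable_snd.
have k0 (w : X * X) : 0 <= h w.2 * Tk w.2 w.1 by rewrite mulr_ge0.
(* Tonelli's theorem makes the old state the outer variable. With [A = setT] this also identifies
   the evidence with the integral of [g]. *)
have swap (P : probability X R) A : measurable A ->
    (\int[leb]_(x in A) ((h x)%:E * pred_SE Tk P x) =
     \int[P]_x' \int[leb]_x (\1_A (x', x).2 * (h x * Tk x x'))%:E)%E.
  move=> mA; rewrite integral_setE.
  pose F (w : X * X) : \bar R := (\1_A w.2 * (h w.2 * Tk w.2 w.1))%:E.
  rewrite (fubini_tonelli F) => [| |w]; last by rewrite lee_fin mulr_ge0.
    apply: eq_integral => x _; rewrite muleA /pred_SE -ge0_integralZl//.
    - by apply: eq_integral => x' _; rewrite /F /= -!EFinM mulrA.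
    - apply/measurable_EFinP.
      exact: measurableT_comp mT' (pair2_measurable x).
    - by move=> x' _; rewrite lee_fin.
    - by rewrite -EFinM lee_fin mulr_ge0.
  apply/measurable_EFinP/measurable_funM => //.
  by apply: measurableT_comp measurable_snd; exact: measurable_indic.
have ZE (P : probability X R) : Z_SE leb h Tk P = (\int[P]_x g_SE leb h Tk x)%E.
  rewrite /Z_SE (swap P setT measurableT); apply: eq_integral => x' _; apply: eq_integral => x _.
  by rewrite indicT mul1r EFinM.
have post (P : probability X R) A : measurable A -> post_SE leb h Tk P A =
    ((\int[P]_x' \int[leb]_x (\1_A (x', x).2 * (h x * Tk x x'))%:E) *
      ((fine (\int[P]_x g_SE leb h Tk x))^-1)%:E)%E.
  by move=> mA; rewrite /post_SE (swap P A mA) ZE.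
rewrite ZE in ZP; rewrite ZE in ZQ.
apply: (posterior_hellinger_le leb snd _ measurable_snd mk k0) => //.
- by move=> A mA; rewrite PE// post.
- by move=> A mA; rewrite QE// post.
Qed.

(** Integrating over [w] last leaves, for each fixed [w], Tonelli's theorem on [X * X]. This
    exchanges old and new states at a fixed parameter. *)
Lemma product_integral_swap {R : realType} {d1 d2} {X : measurableType d1}
    {W : measurableType d2} (lebX : {sigma_finite_measure set X -> \bar R})
    (lebW : {sigma_finite_measure set W -> \bar R}) (F : X * X * W -> R) :
  measurable_fun setT F -> (forall z, 0 <= F z) ->
  (\int[lebX \x lebW]_z \int[lebX]_y (F (z.1, y, z.2))%:E =
   \int[lebX \x lebW]_z \int[lebX]_y (F (y, z.1, z.2))%:E)%E.
Proof.
move=> mF F0.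
have perm12 : measurable_fun setT (fun u : (X * W) * X => (u.1.1, u.2, u.1.2)).
  apply: measurable_fun_pair; first apply: measurable_fun_pair.
  - exact: measurableT_comp measurable_fst measurable_fst.
  - exact: measurable_snd.
  - exact: measurableT_comp measurable_snd measurable_fst.
have perm21 : measurable_fun setT (fun u : (X * W) * X => (u.2, u.1.1, u.1.2)).
  apply: measurable_fun_pair; first apply: measurable_fun_pair.
  - exact: measurable_snd.
  - exact: measurableT_comp measurable_fst measurable_fst.
  - exact: measurableT_comp measurable_snd measurable_fst.
have mint (f : (X * W) * X -> X * X * W) : measurable_fun setT f ->
    measurable_fun setT (fun z => \int[lebX]_y (F (f (z, y)))%:E)%E.
  move=> mf; apply: (measurable_fun_fubini_tonelli_F (fun u => (F (f u))%:E)).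
    by apply/measurable_EFinP; exact: measurableT_comp mF mf.
  by move=> u; rewrite lee_fin.
have int0 (f : (X * W) * X -> X * X * W) z : (0 <= \int[lebX]_y (F (f (z, y)))%:E)%E.
  by apply: integral_ge0 => y _; rewrite lee_fin.
rewrite (fubini_tonelli2 _ (mint _ perm12) (int0 _)).
rewrite (fubini_tonelli2 _ (mint _ perm21) (int0 _)).
apply: eq_integral => w _; rewrite /fubini_G/=.
rewrite (fubini_tonelli (fun u : X * X => (F (u.1, u.2, w))%:E))//.
  apply/measurable_EFinP; apply: (measurableT_comp mF).
  by apply: measurable_fun_pair => //; apply: measurable_fun_pair.
by move=> u; rewrite lee_fin.
Qed.

(** The kernel acts as in SE on the state and keeps the parameter: [phi] replaces the old state by
    the new one and retains [w]. *)
Lemma PS_hellinger_le {R : realType} {d1 d2} {X : measurableType d1}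
    {W : measurableType d2} (lebX : {sigma_finite_measure set X -> \bar R})
    (lebW : {sigma_finite_measure set W -> \bar R})
    (h : X -> W -> R) (Tk : X -> X -> W -> R)
    (P0 Q0 P1 Q1 : probability (X * W)%type R) (piP piQ : X * W -> R)
    (nu : {measure set (X * W)%type -> \bar R}) :
  measurable_fun setT (fun z : X * W => h z.1 z.2) ->
  (forall x w, 0 <= h x w) ->
  measurable_fun setT (fun z : X * X * W => Tk z.1.1 z.1.2 z.2) ->
  (forall x x' w, 0 <= Tk x x' w) ->
  let lam := (lebX \x lebW)%E in
  is_density lam P0 piP -> is_density lam Q0 piQ ->
  (0 < Z_PS lebX h Tk lam piP < +oo)%E -> (0 < Z_PS lebX h Tk lam piQ < +oo)%E ->
  (forall A, measurable A -> P1 A = post_PS lebX h Tk lam piP A) ->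
  (forall A, measurable A -> Q1 A = post_PS lebX h Tk lam piQ A) ->
  let GP := (\int[P0]_z g_PS lebX h Tk z)%E in
  let GQ := (\int[Q0]_z g_PS lebX h Tk z)%E in
  hypH1 (g_PS lebX h Tk) nu P0 Q0 GP GQ \/ hypH2 (g_PS lebX h Tk) nu P0 Q0 GP GQ ->
  hellinger P1 Q1 <= hellinger P0 Q0.
Proof.
move=> mh h0 mT T0 lam dP dQ ZP ZQ PE QE GP GQ.
pose phi (u : (X * W) * X) := (u.2, u.1.2).
pose k (u : (X * W) * X) := h u.2 u.1.2 * Tk u.2 u.1.1 u.1.2.
have mphi : measurable_fun setT phi.
  apply: measurable_fun_pair; first exact: measurable_snd.
  exact: measurableT_comp measurable_snd measurable_fst.
have mperm : measurable_fun setT (fun u : (X * W) * X => (u.2, u.1.1, u.1.2)).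
  apply: measurable_fun_pair; first apply: measurable_fun_pair.
  - exact: measurable_snd.
  - exact: measurableT_comp measurable_fst measurable_fst.
  - exact: measurableT_comp measurable_snd measurable_fst.
have mk : measurable_fun setT k.
  by apply: measurable_funM; [exact: measurableT_comp mh mphi|exact: measurableT_comp mT mperm].
have k0 u : 0 <= k u by rewrite mulr_ge0.
have swap (P : probability (X * W)%type R) pi A : is_density lam P pi -> measurable A ->
    (\int[lam]_(z in A) ((h z.1 z.2)%:E * pred_PS lebX Tk pi z) =
     \int[P]_z \int[lebX]_x (\1_A (phi (z, x)) * k (z, x))%:E)%E.
  move=> dp mA; have [mpi pi0 _] := dp; rewrite integral_setE.
  have mAi : measurable_fun setT (\1_A : X * W -> R) by exact: measurable_indic.
  (* The coordinates of [v] are the new state, the old state and the parameter. *)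
  pose F (v : X * X * W) : R := \1_A (v.1.1, v.2) * h v.1.1 v.2 *
    (Tk v.1.1 v.1.2 v.2 * pi (v.1.2, v.2)).
  have mv1 : measurable_fun setT (fun v : X * X * W => (v.1.1, v.2)).
    apply: measurable_fun_pair; last exact: measurable_snd.
    exact: measurableT_comp measurable_fst measurable_fst.
  have mv2 : measurable_fun setT (fun v : X * X * W => (v.1.2, v.2)).
    apply: measurable_fun_pair; last exact: measurable_snd.
    exact: measurableT_comp measurable_snd measurable_fst.
  have mF : measurable_fun setT F.
    apply: measurable_funM; apply: measurable_funM => //.
    - exact: measurableT_comp mAi mv1.
    - exact: measurableT_comp mh mv1.
    - exact: measurableT_comp mpi mv2.
  transitivity (\int[lam]_z \int[lebX]_y (F (z.1, y, z.2))%:E)%E.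
    apply: eq_integral => -[x w] _; rewrite muleA /pred_PS -ge0_integralZl//=.
    - apply/measurable_EFinP; apply: measurable_funM.
      + apply: (measurableT_comp mT (_ : measurable_fun _ (fun y => (x, y, w)))).
        by apply: measurable_fun_pair => //; exact: measurable_fun_pair.
      + exact: measurableT_comp mpi (pair2_measurable w).
    - by move=> y _; rewrite lee_fin mulr_ge0.
    - by rewrite -EFinM lee_fin mulr_ge0.
  rewrite product_integral_swap// => [|v]; last by rewrite !mulr_ge0.
  have mint : measurable_fun setT
      (fun z => \int[lebX]_x (\1_A (phi (z, x)) * k (z, x))%:E)%E.
    apply: (measurable_fun_fubini_tonelli_F (fun u => (\1_A (phi u) * k u)%:E)).
      by apply/measurable_EFinP/measurable_funM => //; exact: measurableT_comp mAi mphi.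
    by move=> u; rewrite lee_fin mulr_ge0.
  (* After the exchange, [pi] is evaluated at the outer variable, where it combines with [lam] into
     [P]. *)
  rewrite (integral_density _ _ _ dp _ mint); last first.
    by move=> z; apply: integral_ge0 => x _; rewrite lee_fin mulr_ge0.
  apply: eq_integral => -[y w] _; rewrite -ge0_integralZr//=.
  - by apply: eq_integral => x _; rewrite -EFinM /F /phi /k /= !mulrA.
  - apply/measurable_EFinP/measurable_funM.
      exact: measurableT_comp (measurableT_comp mAi mphi) (pair1_measurable (y, w)).
    exact: measurableT_comp mk (pair1_measurable (y, w)).
  - by move=> x _; rewrite lee_fin mulr_ge0.
  - by rewrite lee_fin.
have ZE (P : probability (X * W)%type R) pi : is_density lam P pi ->
    Z_PS lebX h Tk lam pi = (\int[P]_z g_PS lebX h Tk z)%E.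
  move=> dp; rewrite /Z_PS (swap P pi setT dp measurableT).
  apply: eq_integral => z _; apply: eq_integral => x _.
  by rewrite indicT mul1r EFinM.
have post (P : probability (X * W)%type R) pi A : is_density lam P pi -> measurable A ->
    post_PS lebX h Tk lam pi A =
    ((\int[P]_z \int[lebX]_x (\1_A (phi (z, x)) * k (z, x))%:E) *
      ((fine (\int[P]_z g_PS lebX h Tk z))^-1)%:E)%E.
  by move=> dp mA; rewrite /post_PS (swap P pi A dp mA) (ZE P pi dp).
rewrite (ZE _ _ dP) in ZP; rewrite (ZE _ _ dQ) in ZQ.
apply: (posterior_hellinger_le lebX phi k mphi mk k0) => //.
- by move=> A mA; rewrite PE// (post _ _ _ dP).
- by move=> A mA; rewrite QE// (post _ _ _ dQ).
Qed.

Theorem theorem4 (R : realType) :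
  (* ---------------- Problem IP ---------------- *)
  (forall (d : measure_display) (X : measurableType d) (h : X -> R)
      (P0 Q0 P1 Q1 : probability X R),
    measurable_fun setT h -> (forall x, 0 <= h x) ->
    admissible_IP h P0 -> admissible_IP h Q0 ->
    (forall A, measurable A -> P1 A = post_IP h P0 A) ->
    (forall A, measurable A -> Q1 A = post_IP h Q0 A) ->
    let GP := (\int[P0]_x g_IP h x)%E in
    let GQ := (\int[Q0]_x g_IP h x)%E in
    (exists nu : {sigma_finite_measure set X -> \bar R},
        hypH1 (g_IP h) nu P0 Q0 GP GQ) \/
    (exists nu : {sigma_finite_measure set X -> \bar R},
        hypH2 (g_IP h) nu P0 Q0 GP GQ) ->
    hellinger P1 Q1 <= hellinger P0 Q0)
  /\
  (* ---------------- Problem SE ---------------- *)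
  (forall (d : measure_display) (X : measurableType d)
      (leb : {sigma_finite_measure set X -> \bar R})
      (h : X -> R) (Tk : X -> X -> R)
      (P0 Q0 P1 Q1 : probability X R),
    measurable_fun setT h -> (forall x, 0 <= h x) ->
    measurable_fun setT (fun z : X * X => Tk z.1 z.2) ->
    (forall x x', 0 <= Tk x x') ->
    (forall x', (\int[leb]_x (Tk x x')%:E)%E = 1%E) ->
    admissible_SE leb h Tk P0 -> admissible_SE leb h Tk Q0 ->
    (forall A, measurable A -> P1 A = post_SE leb h Tk P0 A) ->
    (forall A, measurable A -> Q1 A = post_SE leb h Tk Q0 A) ->
    let GP := (\int[P0]_x g_SE leb h Tk x)%E in
    let GQ := (\int[Q0]_x g_SE leb h Tk x)%E in
    (exists nu : {sigma_finite_measure set X -> \bar R},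
        hypH1 (g_SE leb h Tk) nu P0 Q0 GP GQ) \/
    (exists nu : {sigma_finite_measure set X -> \bar R},
        hypH2 (g_SE leb h Tk) nu P0 Q0 GP GQ) ->
    hellinger P1 Q1 <= hellinger P0 Q0)
  /\
  (* ---------------- Problem PS ---------------- *)
  (forall (d1 d2 : measure_display) (X : measurableType d1)
      (W : measurableType d2)
      (lebX : {sigma_finite_measure set X -> \bar R})
      (lebW : {sigma_finite_measure set W -> \bar R})
      (h : X -> W -> R) (Tk : X -> X -> W -> R)
      (P0 Q0 P1 Q1 : probability (X * W)%type R) (piP piQ : X * W -> R),
    measurable_fun setT (fun z : X * W => h z.1 z.2) ->
    (forall x w, 0 <= h x w) ->
    measurable_fun setT (fun z : X * X * W => Tk z.1.1 z.1.2 z.2) ->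
    (forall x x' w, 0 <= Tk x x' w) ->
    (forall x' w, (\int[lebX]_x (Tk x x' w)%:E)%E = 1%E) ->
    let lam := (lebX \x lebW)%E in
    admissible_PS lebX h Tk lam P0 piP -> admissible_PS lebX h Tk lam Q0 piQ ->
    (forall A, measurable A -> P1 A = post_PS lebX h Tk lam piP A) ->
    (forall A, measurable A -> Q1 A = post_PS lebX h Tk lam piQ A) ->
    let GP := (\int[P0]_z g_PS lebX h Tk z)%E in
    let GQ := (\int[Q0]_z g_PS lebX h Tk z)%E in
    hypH1 (g_PS lebX h Tk) lam P0 Q0 GP GQ \/
    hypH2 (g_PS lebX h Tk) lam P0 Q0 GP GQ ->
    hellinger P1 Q1 <= hellinger P0 Q0).
Proof.
split; [|split].
- move=> d X h P0 Q0 P1 Q1 mh h0 aP aQ PE QE GP GQ.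
  by case=> -[nu H]; apply: (IP_hellinger_le h P0 Q0 P1 Q1 nu) => //; [left|right].
- move=> d X leb h Tk P0 Q0 P1 Q1 mh h0 mT T0 _ [_ ZP] [_ ZQ] PE QE GP GQ.
  by case=> -[nu H]; apply: (SE_hellinger_le leb h Tk P0 Q0 P1 Q1 nu) => //; [left|right].
- move=> d1 d2 X W lebX lebW h Tk P0 Q0 P1 Q1 piP piQ mh h0 mT T0 _ lam.
  move=> [dP _ ZP] [dQ _ ZQ] PE QE GP GQ.
  exact: (PS_hellinger_le lebX lebW h Tk P0 Q0 P1 Q1 piP piQ).
Qed.
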